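(* Let $V$ be a finite-dimensional irreducible $\mathcal H_q$-module. Then there exist $a,b,c\in\mathbb C$ with $b\neq0$ and $d\in\mathbb N$ such that $V$ is isomorphic to the $\mathcal H_q$-module $V_d(a,b,c)$.
   Context: Throughout, $q$ is a nonzero complex number that is not a root of unity; $[x,y]_q=qxy-q^{-1}yx$. The universal $q$-Hahn algebra $\mathcal H_q$ is the algebra over $\mathbb C$ generated by $A,B,C$ subject to the relations that each of $\frac{[B,C]_q}{q^2-q^{-2}}+A$, $[C,A]_q$, $\frac{[A,B]_q}{q^2-q^{-2}}+C$ commutes with $A,B,C$. For $a,c\in\mathbb C$, $b\in\mathbb C\setminus\{0\}$, $d\in\mathbb N$, put $\nu=q^d$ and $\theta_i=a\nu q^{-2i}$, $\theta_i^*=b\nu q^{-2i}+b^{-1}\nu^{-1}q^{2i}$, $\theta_i^\varepsilon=c\nu^{-1}q^{2i}$, $\varphi_i=(q^i-q^{-i})(\nu q^{1-i}-\nu^{-1}q^{i-1})(c-ab\nu q^{1-2i})$, $\varphi_i^\varepsilon=(q^i-q^{-i})(\nu q^{1-i}-\nu^{-1}q^{i-1})(a-b^{-1}c\nu^{-1}q^{2i-1})$. Then $V_d(a,b,c)$ is the $(d+1)$-dimensional $\mathcal H_q$-module with basis $m_0,\dots,m_d$ such that $(A-\theta_0)m_0=0$, $(A-\theta_i)m_i=\varphi_im_{i-1}$ ($1\le i\le d$); $(B-\theta_i^* )m_i=m_{i+1}$ ($0\le i\le d-1$), $(B-\theta_d^* )m_d=0$; $(C-\theta_0^\varepsilon)m_0=0$,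 $(C-\theta_i^\varepsilon)m_i=\varphi_i^\varepsilon m_{i-1}$ ($1\le i\le d$). *)

(* Defs.v *)
From HB Require Import structures.
From mathcomp Require Import all_boot all_order all_algebra.
From mathcomp Require Import complex.
From mathcomp Require Import Rstruct.
Set Implicit Arguments. Unset Strict Implicit. Unset Printing Implicit Defensive.
Import Order.TTheory GRing.Theory Num.Theory.
Local Open Scope ring_scope.

Definition Cplx : fieldType := (Rdefinitions.R)[i].

Section Hq.
Variable K : fieldType.

Definition not_root_of_unity (q : K) := q != 0 /\ forall n : nat, (0 < n)%N -> q ^+ n != 1.

Section Module.
Variable V : vectType K.
Implicit Types f g : 'End(V).

Definition qbracket (q : K) f g : 'End(V) :=
  q *: (f \o g)%VF - q^-1 *: (g \o f)%VF.

Definition commutes f g := (f \o g = g \o f)%VF.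

Definition central3 (X A B C : 'End(V)) :=
  [/\ commutes X A, commutes X B & commutes X C].

(* A, B, C : 'End(V) make V an H_q-module (the defining relations of the
   universal q-Hahn algebra). *)
Definition is_Hq_module (q : K) (A B C : 'End(V)) :=
  [/\ central3 ((q ^+ 2 - q ^- 2)^-1 *: qbracket q B C + A) A B C,
      central3 (qbracket q C A) A B C
    & central3 ((q ^+ 2 - q ^- 2)^-1 *: qbracket q A B + C) A B C].

Definition Hq_irreducible (A B C : 'End(V)) :=
  (0 < \dim {:V})%N /\
  forall U : {vspace V},
    (A @: U <= U)%VS -> (B @: U <= U)%VS -> (C @: U <= U)%VS ->
    U = 0%VS \/ U = fullv.
End Module.

Definition Hq_isomorphic (V W : vectType K) (A B C : 'End(V)) (A' B' C' : 'End(W)) :=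
  exists phi : 'Hom(V, W),
    [/\ lker phi = 0%VS, limg phi = fullv,
        (phi \o A = A' \o phi)%VF, (phi \o B = B' \o phi)%VF
      & (phi \o C = C' \o phi)%VF].

(* The module V_d(a,b,c), realized on column vectors 'cV_(d+1), where the
   basis vector m_j is the j-th standard column vector (j = 0..d). *)
Definition th (q a b c : K) (d : nat) (i : nat) : K :=
  a * q ^+ d * q ^ (- (2 * i)%:Z).
Definition ths (q a b c : K) (d : nat) (i : nat) : K :=
  b * q ^+ d * q ^ (- (2 * i)%:Z) + b^-1 * (q ^+ d)^-1 * q ^ (2 * i)%:Z.
Definition the (q a b c : K) (d : nat) (i : nat) : K :=
  c * (q ^+ d)^-1 * q ^ (2 * i)%:Z.
Definition ph (q a b c : K) (d : nat) (i : nat) : K :=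
  (q ^ i%:Z - q ^ (- i%:Z))
  * (q ^+ d * q ^ (1 - i%:Z) - (q ^+ d)^-1 * q ^ (i%:Z - 1))
  * (c - a * b * q ^+ d * q ^ (1 - (2 * i)%:Z)).
Definition phe (q a b c : K) (d : nat) (i : nat) : K :=
  (q ^ i%:Z - q ^ (- i%:Z))
  * (q ^+ d * q ^ (1 - i%:Z) - (q ^+ d)^-1 * q ^ (i%:Z - 1))
  * (a - b^-1 * c * (q ^+ d)^-1 * q ^ ((2 * i)%:Z - 1)).

(* Matrices on the basis m_0..m_d of 'cV_(d+1) (m_j = j-th standard column);
   entry (i, j) = coefficient of m_i in X m_j. *)
Definition VdA (q a b c : K) (d : nat) : 'M[K]_d.+1 :=
  \matrix_(i, j) (if i == j :> nat then th q a b c d j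
                  else if (i.+1 == j :> nat) then ph q a b c d j else 0).
Definition VdB (q a b c : K) (d : nat) : 'M[K]_d.+1 :=
  \matrix_(i, j) (if i == j :> nat then ths q a b c d j
                  else if (i == j.+1 :> nat) then 1 else 0).
Definition VdC (q a b c : K) (d : nat) : 'M[K]_d.+1 :=
  \matrix_(i, j) (if i == j :> nat then the q a b c d j
                  else if (i.+1 == j :> nat) then phe q a b c d j else 0).

Definition Vd_A (q a b c : K) (d : nat) : 'End('cV[K]_d.+1) :=
  linfun (fun v : 'cV[K]_d.+1 => VdA q a b c d *m v).
Definition Vd_B (q a b c : K) (d : nat) : 'End('cV[K]_d.+1) :=
  linfun (fun v : 'cV[K]_d.+1 => VdB q a b c d *m v).
Definition Vd_C (q a b c : K) (d : nat) : 'End('cV[K]_d.+1) :=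
  linfun (fun v : 'cV[K]_d.+1 => VdC q a b c d *m v).
End Hq.

(* Main.v *)
Require Import Defs.
From HB Require Import structures.
From mathcomp Require Import all_boot all_order all_algebra.
From mathcomp Require Import complex Rstruct ring.
Import GRing.Theory passmx.
Local Open Scope ring_scope.
Set Implicit Arguments. Unset Strict Implicit. Unset Printing Implicit Defensive.

(** By Schur's lemma the three central elements act as scalars.  The relation
[q C A - q^-1 A C = const] makes [C A - const'] q-commute with [A], hence singular,
and on its kernel [A] and [C] commute; so they have a common eigenvector [v0], with
eigenvalues [la] and [mu].  The other two relations show that the vectors [B^i v0] span
[V] and that [A] and [C] are triangular on the basis [v0, ..., B^d v0], with diagonals
[la q^(-2i)] and [mu q^(2i)].  Let [t] be the coefficient of [B^d v0] in [B^(d+1) v0],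
that is the trace of [B].  Comparing coefficients of [B^d v0] in [A B^(d+1) v0] and
[C B^(d+1) v0] expresses the two remaining central scalars through [la], [mu], [t], [d].
In [V_d(a,b,c)] the trace of [B] is [(b + b^-1) [d+1]_q], so [b] is found by solving
[b + b^-1 = t / [d+1]_q], while [a = la / q^d] and [c = mu q^d].  The vectors
[m_i = prod_(h<i) (B - theta*_h) v0] then satisfy the required formulas, and
[m_(d+1) = 0] because it would be an eigenvector of [A] and [C] with eigenvalues
[la q^(-2(d+1))] and [mu q^(2(d+1))] missing from the diagonals, unless
[la = mu = 0], in which case [A = C = 0] and [d = 0]. *)

(** * Powers of a non-root of unity, linear functionals and eigenvalues *)

Lemma expf_inj_not_root (K : fieldType) (r : K) : r != 0 ->
  (forall n, (0 < n)%N -> r ^+ n != 1) -> injective (fun n => r ^+ n).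
Proof.
move=> r0 rN1 i j; wlog ij: i j / (i <= j)%N => [H|].
  by case/orP: (leq_total i j) => ij e; [|symmetry]; apply: H.
move=> /= e; apply/eqP; rewrite eqn_leq ij leqNgt -subn_gt0; apply/negP => /rN1.
by rewrite -(inj_eq (mulfI (expf_neq0 i r0))) -exprD subnKC // mulr1 e eqxx.
Qed.

Lemma lfunZ (K : fieldType) (V W : vectType K) (f : 'Hom(V, W)) (a : K) v :
  f (a *: v) = a *: f v.
Proof. exact: linearZ. Qed.

Lemma lfunD (K : fieldType) (V W : vectType K) (f : 'Hom(V, W)) v w :
  f (v + w) = f v + f w.
Proof. exact: linearD. Qed.

Lemma lfunN (K : fieldType) (V W : vectType K) (f : 'Hom(V, W)) v :
  f (- v) = - f v.
Proof. exact: linearN. Qed.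

(** The coordinates in a basis are among the functionals [h], and they determine a vector. *)
Lemma scalar_ext (K : fieldType) (V : vectType K) (x y : V) :
  (forall h : V -> K, {morph h : v w / v + w} -> {morph h : v / - v} ->
    (forall c v, h (c *: v) = c * h v) -> h 0 = 0 -> h x = h y) -> x = y.
Proof.
move=> hxy; rewrite (coord_vbasis (memvf x)) (coord_vbasis (memvf y)).
by apply: eq_bigr => i _; congr (_ *: _); apply: hxy;
  [exact: linearD|exact: linearN|by move=> c v; rewrite linearZ|exact: linear0].
Qed.

(* Scalar functionals separate the points, which turns identities between
   linear combinations of vectors into identities for [ring] and [field]. *)
Ltac to_scalars :=
  rewrite ?(lfunD, lfunN, lfunZ);
  let h := fresh "h" in let hD := fresh in let hN := fresh in
  let hZ := fresh in let h0 := fresh in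
  apply: scalar_ext => h hD hN hZ h0; rewrite ?(hD, hN, hZ, h0); clear hD hN hZ h0.
Ltac lmod_ring := to_scalars; ring.

(** The characteristic polynomial serves; its size is recorded both to find an eigenvalue and to
    bound the number of eigenvalues. *)
Lemma leigenvalue_root (K : fieldType) (V : vectType K) (f : 'End(V)) :
  exists2 p : {poly K}, size p = (\dim {:V}).+1 &
    forall x, leigenvalue f x = root p x.
Proof.
have e_basis := vbasisP {:V}.
exists (char_poly (mxof (vbasis {:V}) (vbasis {:V}) f)); first exact: size_char_poly.
move=> x; rewrite /leigenvalue (leigenspaceE e_basis).
by rewrite vsof_eq0 // -eigenvalue_root_char.
Qed.

Lemma leigenspaceP (K : fieldType) (V : vectType K) (f : 'End(V)) x v :
  reflect (f v = x *: v) (v \in leigenspace f x).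
Proof. by rewrite /leigenspace memv_ker !lfun_simp subr_eq0; apply: eqP. Qed.

Lemma leigenvalueP (K : fieldType) (V : vectType K) (f : 'End(V)) x :
  reflect (exists2 v, v != 0 & f v = x *: v) (leigenvalue f x).
Proof.
apply: (iffP idP) => [h|[v v0 fv]].
  exists (vpick (leigenspace f x)); first by rewrite vpick0.
  exact/leigenspaceP/memv_pick.
apply: contraNneq v0 => k0; rewrite -memv0 -k0; exact/leigenspaceP.
Qed.

(** * Eigenvectors over an algebraically closed field *)

Section Closed.
Variable K : fieldType.
Hypothesis Kclosed : forall p : {poly K}, size p != 1%N -> exists x, root p x.

Lemma exists_eigenvector (V : vectType K) (f : 'End(V)) :
  (0 < \dim {:V})%N -> exists x, exists2 v, v != 0 & f v = x *: v.
Proof.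
have [p sp fp] := leigenvalue_root f => V0.
have [|x rx] := @Kclosed p; first by rewrite sp eqSS -lt0n.
by exists x; apply/leigenvalueP; rewrite fp.
Qed.

Lemma exists_eigenvector_in (V : vectType K) (f : 'End(V)) (U : {vspace V}) :
  U != 0%VS -> (f @: U <= U)%VS ->
  exists x v, [/\ v \in U, v != 0 & f v = x *: v].
Proof.
move=> U0 fU.
have [|x [v v0 fv]] := @exists_eigenvector (subvs_of U) (linfun (vsproj U \o f \o vsval)).
  by rewrite dimvf /dim /= lt0n dimv_eq0.
exists x, (vsval v); split; first exact: subvsP.
  by apply: contra v0 => /eqP v0; apply/eqP/val_inj.
move/(congr1 vsval): fv; rewrite lfunE /= vsprojK ?linearZ //.
by apply: subvP fU _ _; rewrite memv_img ?subvsP.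
Qed.

(* The spectrum is finite, so it cannot contain an infinite orbit of scaling. *)
Lemma singular_of_scaled_spectrum (V : vectType K) (f : 'End(V)) (r : K) :
  (0 < \dim {:V})%N -> r != 0 -> (forall n, (0 < n)%N -> r ^+ n != 1) ->
  (forall x, leigenvalue f x -> leigenvalue f (r * x)) -> lker f != 0%VS.
Proof.
move=> V0 r0 rN1 fr; have [x [v v0 fv]] := exists_eigenvector f V0.
case: (eqVneq x 0) => [x0|x0].
  apply: contraNneq v0 => k0; rewrite -memv0 -k0 memv_ker fv x0 scale0r //.
have fx n : leigenvalue f (r ^+ n * x).
  elim: n => [|n IH]; last by rewrite exprS -mulrA fr.
  by rewrite expr0 mul1r; apply/leigenvalueP; exists v.
have [p sp fp] := leigenvalue_root f.
have := @max_poly_roots _ p [seq r ^+ n * x | n <- iota 0 (size p)].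
rewrite size_map size_iota ltnn -size_poly_eq0 sp => H; exfalso.
suff: false by []. apply: H => //.
  by apply/allP => y /mapP [n _ ->]; rewrite -fp.
rewrite map_inj_in_uniq ?iota_uniq // => i j _ _ /(mulIf x0).
exact: expf_inj_not_root.
Qed.

(* Since [A Y = r Y A] for [Y := C A - b], the kernel of [Y] is a nonzero
   submodule on which [A] and [C] commute. *)
Lemma common_eigenvector_of_qcommuting (V : vectType K) (A C : 'End(V)) (r b : K) :
  (0 < \dim {:V})%N -> r != 0 -> (forall n, (0 < n)%N -> r ^+ n != 1) ->
  (forall v, A (C v) - b *: v = r *: (C (A v) - b *: v)) ->
  exists x y v, [/\ v != 0, A v = x *: v & C v = y *: v].
Proof.
move=> V0 r0 rN1 AC.
have [Y YE] : exists Y : 'End(V), forall v, Y v = C (A v) - b *: v.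
  by exists (C \o A - b *: \1)%VF => v; rewrite !lfun_simp.
have ACY v : A (C v) = r *: Y v + b *: v by rewrite YE -AC subrK.
have CAY v : C (A v) = Y v + b *: v by rewrite YE subrK.
have Y0 : lker Y != 0%VS.
  apply: (@singular_of_scaled_spectrum _ Y r^-1) => //.
  - by rewrite invr_eq0.
  - by move=> n n0; rewrite exprVn invr_eq1 rN1.
  move=> x /leigenvalueP [v v0 Yv]; apply/leigenvalueP.
  (* An eigenvalue [x] of [Y] is an eigenvalue [x + b] of [C A], hence of [A C], and
     [A C - b = r Y]. *)
  suff [w w0 ACw] : exists2 w, w != 0 & A (C w) = (x + b) *: w.
    exists w => //; apply: (scalerI r0); apply: (addIr (b *: w)).
    by rewrite -ACY ACw scalerDl scalerA mulVKf.
  have CAv : C (A v) = (x + b) *: v by rewrite CAY Yv scalerDl.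
  case: (eqVneq (A v) 0) => [Av0|Av0]; last by exists (A v); rewrite ?CAv ?linearZ.
  move/eqP: CAv; rewrite Av0 linear0 eq_sym scaler_eq0 (negbTE v0) orbF.
  (* Here [x + b = 0], so a kernel vector of [A C] is wanted: pull [v] back through [C] if [C] is
     injective, otherwise pick a vector killed by [C]. *)
  move=> /eqP ->; have [kC|kC] := eqVneq (lker C) 0%VS.
    have CVK := @lker0_lfunVK _ _ C (introT eqP kC).
    exists ((C^-1)%VF v); last by rewrite CVK Av0 scale0r.
    by apply: contraNneq v0 => /(congr1 C); rewrite CVK linear0 => ->.
  exists (vpick (lker C)); first by rewrite vpick0.
  by have := memv_pick (lker C); rewrite memv_ker => /eqP ->; rewrite linear0 scale0r.
have YP v : reflect (Y v = 0) (v \in lker Y) by rewrite memv_ker; exact: eqP.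
have AY v : Y (A v) = r^-1 *: A (Y v).
  by apply: (scalerI r0); rewrite scalerA divff // scale1r YE -AC CAY linearD /= lfunZ addrK.
have CY v : Y (C v) = r *: C (Y v).
  by rewrite YE ACY linearD /= !lfunZ addrK.
have stab_ker : (A @: lker Y <= lker Y)%VS.
  by apply/subvP => _ /memv_imgP [v /YP Yv ->]; apply/YP; rewrite AY Yv linear0 scaler0.
have [x [v [/YP Yv v0 Av]]] := exists_eigenvector_in Y0 stab_ker.
(* On [lker Y] both [A C] and [C A] are multiplication by [b], so [C] preserves the eigenspaces of
   [A] there. *)
pose U := (lker Y :&: leigenspace A x)%VS.
have UP w : reflect (Y w = 0 /\ A w = x *: w) (w \in U).
  rewrite memv_cap; apply: (iffP andP) => [[/YP ? /leigenspaceP ?]|[? ?]] //.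
  by split; [apply/YP|apply/leigenspaceP].
have U0 : U != 0%VS.
  by apply: contraNneq v0 => U0; rewrite -memv0 -U0; apply/UP.
have CU : (C @: U <= U)%VS.
  apply/subvP => _ /memv_imgP [w /UP [Yw Aw] ->]; apply/UP.
  split; first by rewrite CY Yw linear0 scaler0.
  by rewrite ACY Yw scaler0 -lfunZ -Aw CAY Yw.
have [y [w [/UP [_ Aw] w0 Cw]]] := exists_eigenvector_in U0 CU.
by exists x, y, w.
Qed.

(** * Submodules of an irreducible module and Schur's lemma *)

Section Irreducible.
Variables (V : vectType K) (A B C : 'End(V)).
Hypothesis irr : Hq_irreducible A B C.

Lemma Hq_irreducible_submodule (U : {vspace V}) w : w != 0 -> w \in U ->
  (forall v, v \in U -> A v \in U) -> (forall v, v \in U -> B v \in U) ->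
  (forall v, v \in U -> C v \in U) -> U = fullv.
Proof.
move=> w0 wU hA hB hC; case: irr => _ /(_ U) []; rewrite ?subv_image //.
1-3: by apply/subvP => _ /memv_imgP [v vU ->]; auto.
by move=> U0; move: wU w0; rewrite U0 memv0 => ->.
Qed.

(** An eigenspace of [X] is a nonzero submodule, because [X] commutes with the generators. *)
Lemma central_scalar (X : 'End(V)) : central3 X A B C -> exists x, forall v, X v = x *: v.
Proof.
move=> [XA XB XC]; have [x [w w0 Xw]] := exists_eigenvector X (proj1 irr).
have stab (f : 'End(V)) : commutes X f -> forall v, v \in leigenspace X x -> f v \in leigenspace X x.
  move=> Xf v /leigenspaceP Xv; apply/leigenspaceP; have := congr1 (fun g : 'End(V) => g v) Xf.
  by rewrite !comp_lfunE => ->; rewrite Xv linearZ.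
exists x => v; apply/leigenspaceP.
rewrite (@Hq_irreducible_submodule (leigenspace X x) w) ?memvf //; try exact: stab.
exact/leigenspaceP.
Qed.
End Irreducible.
End Closed.

(** * Krylov subspaces of [B] *)

Section Krylov.
Variables (K : fieldType) (V : vectType K) (B : 'End(V)) (v0 : V).

Definition krylov n : {vspace V} := <<mkseq (fun i => iter i B v0) n>>%VS.

Lemma krylov0 : krylov 0 = 0%VS. Proof. exact: span_nil. Qed.

Lemma krylovS n : krylov n.+1 = (krylov n + <[iter n B v0]>)%VS.
Proof. by rewrite /krylov mkseqS -cats1 span_cat span_seq1. Qed.

Lemma krylov_subS n : (krylov n <= krylov n.+1)%VS.
Proof. by rewrite krylovS addvSl. Qed.

Lemma mem_krylovS n x : x \in krylov n -> x \in krylov n.+1.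
Proof. exact: (subvP (krylov_subS n)). Qed.

Lemma iter_krylov n : iter n B v0 \in krylov n.+1.
Proof. by rewrite krylovS (subvP (addvSr _ _)) ?memv_line. Qed.

Lemma krylovSP n x : reflect (exists c, x - c *: iter n B v0 \in krylov n)
  (x \in krylov n.+1).
Proof.
rewrite krylovS; apply: (iffP memv_addP) => [[w wW [_ /vlineP [c ->] ->]]|[c cW]].
  by exists c; rewrite addrK.
exists (x - c *: iter n B v0) => //; exists (c *: iter n B v0); rewrite ?subrK //.
by rewrite memvZ ?memv_line.
Qed.

Lemma krylov_image n x : x \in krylov n -> B x \in krylov n.+1.
Proof.
elim: n x => [|n IH] x; first by rewrite krylov0 memv0 => /eqP ->; rewrite linear0 mem0v.
case/krylovSP => c /IH Bx.
rewrite -(subrK (c *: B (iter n B v0)) (B x)) -lfunZ -linearB.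
by apply: memvD; [apply: mem_krylovS|rewrite lfunZ memvZ // -iterS iter_krylov].
Qed.

Lemma krylov_stable n x : iter n B v0 \in krylov n -> x \in krylov n -> B x \in krylov n.
Proof.
move=> vn /krylov_image /krylovSP [c cW].
by rewrite -(subrK (c *: iter n B v0) (B x)) memvD // memvZ.
Qed.
End Krylov.

(** * Triangular action of [A] and [C] on the Krylov subspaces *)

Section Triangular.
Variables (K : fieldType) (V : vectType K) (f g B : 'End(V)) (v0 : V).
Variables (r r' k l ga al x0 y0 : K).
Hypothesis fB : forall x, f (B x) = r *: B (f x) + k *: (ga *: x - g x).
Hypothesis gB : forall x, g (B x) = r' *: B (g x) + l *: (al *: x - f x).
Hypothesis fv0 : f v0 = x0 *: v0.
Hypothesis gv0 : g v0 = y0 *: v0.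
Let v i := iter i B v0.
Let W := krylov B v0.

(** The relations for [f] and [g] have the same shape, so that [(f, g)] can be [(A, C)] or [(C, A)].
    At [x = v n] the correction [ga *: x - g x] stays in [W n.+1], so only [r *: B (f x)] reaches
    [v n.+1] and the diagonal entry is multiplied by [r]. Each map occurs in the correction of the
    other, hence the joint induction. *)
Lemma krylov_diag n :
  f (v n) - (r ^+ n * x0) *: v n \in W n /\ g (v n) - (r' ^+ n * y0) *: v n \in W n.
Proof.
elim: n => [|n [fn gn]]; first by rewrite /v /= !mul1r fv0 gv0 !subrr mem0v.
have fW : f (v n) \in W n.+1 by apply/krylovSP; exists (r ^+ n * x0).
have gW : g (v n) \in W n.+1 by apply/krylovSP; exists (r' ^+ n * y0).
have vW : v n \in W n.+1 by apply: iter_krylov.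
have key (h : 'End(V)) (c d : K) w : h (v n) - c *: v n \in W n -> w \in W n.+1 ->
    d *: B (h (v n)) + w - (d * c) *: v n.+1 \in W n.+1.
  move=> hn wW; have vS : v n.+1 = B (v n) by [].
  have -> : d *: B (h (v n)) + w - (d * c) *: v n.+1 = d *: B (h (v n) - c *: v n) + w.
    by rewrite vS; lmod_ring.
  by apply: memvD => //; apply/memvZ/krylov_image.
have vS : v n.+1 = B (v n) by [].
split.
  rewrite {1}vS fB exprS -mulrA; apply: key => //.
  by apply/memvZ/memvB => //; apply: memvZ.
rewrite {1}vS gB exprS -mulrA; apply: key => //.
by apply/memvZ/memvB => //; apply: memvZ.
Qed.

Lemma krylov_iter_in_f n : f (v n) \in W n.+1 /\ g (v n) \in W n.+1.
Proof.
by have [fn gn] := krylov_diag n; split; apply/krylovSP;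
  [exists (r ^+ n * x0)|exists (r' ^+ n * y0)].
Qed.

Lemma krylov_f_stable n x : x \in W n -> f x \in W n.
Proof.
elim: n x => [|n IH] x; first by rewrite /W krylov0 !memv0 => /eqP ->; rewrite linear0.
case/krylovSP => c /IH fx; rewrite -(subrK (c *: f (v n)) (f x)) -lfunZ -linearB.
apply: memvD; first exact: mem_krylovS.
by rewrite lfunZ memvZ //; have [] := krylov_iter_in_f n.
Qed.

(** The matrix entry of [f] just above the diagonal: the coefficient of [v n.-1] in [f (v n)]. Only
    the diagonal entry of [g] enters the recursion, since the rest of [g (v n)] lies too low. *)
Fixpoint krylov_offdiag n :=
  if n is n'.+1 then r * krylov_offdiag n' + k * (ga - r' ^+ n' * y0) else 0.

Lemma krylov_offdiagP n :
  f (v n.+1) - (r ^+ n.+1 * x0) *: v n.+1 - krylov_offdiag n.+1 *: v n \in W n.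
Proof.
have vS i : v i.+1 = B (v i) by [].
elim: n => [|n IH]; rewrite {1}vS fB.
  rewrite [X in X \in _](_ : _ = 0) ?mem0v // vS /v /= fv0 gv0; lmod_ring.
set c := krylov_offdiag n.+1 in IH *.
have -> : krylov_offdiag n.+2 = r * c + k * (ga - r' ^+ n.+1 * y0) by [].
have -> : r *: B (f (v n.+1)) + k *: (ga *: v n.+1 - g (v n.+1)) - (r ^+ n.+2 * x0) *: v n.+2
    - (r * c + k * (ga - r' ^+ n.+1 * y0)) *: v n.+1 =
  r *: B (f (v n.+1) - (r ^+ n.+1 * x0) *: v n.+1 - c *: v n)
    - k *: (g (v n.+1) - (r' ^+ n.+1 * y0) *: v n.+1).
  by rewrite (vS n.+1) !(lfunD, lfunN, lfunZ) -(vS n) [r ^+ n.+2]exprS; lmod_ring.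
apply: memvB; apply: memvZ; first exact: krylov_image.
by have [] := krylov_diag n.+1.
Qed.

(** Modulo [W n], [f (v n.+1)] is [(r ^+ n.+1 * x0 * t + krylov_offdiag n.+1) *: v n] by
    triangularity, and [(t * r ^+ n * x0) *: v n] because [v n.+1] is congruent to [t *: v n]. If
    the two coefficients differed, [v n] would lie in [W n]. *)
Lemma krylov_offdiag_closed n t : v n \notin W n -> v n.+1 - t *: v n \in W n ->
  krylov_offdiag n.+1 = (1 - r) * r ^+ n * x0 * t.
Proof.
move=> vn vS; have f1 := krylov_offdiagP n; have [f2 _] := krylov_diag n.
have f3 := krylov_f_stable vS.
apply/eqP; rewrite -subr_eq0; apply: contraR vn => c0.
set c := (X in X != 0) in c0.
rewrite -[v n]scale1r -(mulVf c0) -scalerA memvZ //.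
have -> : c *: v n = t *: (f (v n) - (r ^+ n * x0) *: v n)
   + f (v n.+1 - t *: v n) - (f (v n.+1) - (r ^+ n.+1 * x0) *: v n.+1 - krylov_offdiag n.+1 *: v n)
   - (r ^+ n.+1 * x0) *: (v n.+1 - t *: v n) by rewrite /c exprS; lmod_ring.
by apply: memvB; [apply: memvB => //; apply: memvD => //|]; apply: memvZ.
Qed.

(** The leading coefficient of an eigenvector must vanish when [z] is off the diagonal, so the
    vector descends through the flag down to [W 0 = 0]. *)
Lemma krylov_eigenvector_eq0 n x z : x \in W n -> f x = z *: x ->
  (forall i, (i < n)%N -> z != r ^+ i * x0) -> x = 0.
Proof.
elim: n => [|n IH] xW fx zN; first by apply/eqP; rewrite -memv0 -(krylov0 B v0).
apply: IH => // [|i ltin]; last by rewrite zN // ltnW.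
case/krylovSP: xW => c xW; have f1 := krylov_f_stable xW; have [f2 _] := krylov_diag n.
have := zN n (ltnSn n); rewrite -subr_eq0 => c0.
rewrite -[x]scale1r -(mulVf c0) -scalerA memvZ //.
have -> : (z - r ^+ n * x0) *: x = f (x - c *: v n) + c *: (f (v n) - (r ^+ n * x0) *: v n)
  - (r ^+ n * x0) *: (x - c *: v n) by rewrite lfunD fx; lmod_ring.
by rewrite memvB ?memvD // memvZ.
Qed.
End Triangular.

Section KrylovDim.
Variables (K : fieldType) (V : vectType K) (B : 'End(V)) (v0 : V).

Lemma dim_krylov n : (forall i, (i < n)%N -> iter i B v0 \notin krylov B v0 i) ->
  \dim (krylov B v0 n) = n.
Proof.
move=> H; suff /eqnP -> : free (mkseq (fun i => iter i B v0) n) by rewrite size_mkseq.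
elim: n H => [|n IH] H; first exact: nil_free.
rewrite mkseqS (perm_free (permEl (perm_rcons _ _))) free_cons H ?ltnSn //=.
by apply: IH => i /ltnW/H.
Qed.

Lemma krylov_stops : v0 != 0 -> exists d, [/\ iter d B v0 \notin krylov B v0 d,
  iter d.+1 B v0 \in krylov B v0 d.+1 & \dim (krylov B v0 d.+1) = d.+1].
Proof.
(* The index is shifted by one because [v0 != 0] already settles index 0; the least [n] with [P n]
   is the required [d], and it exists by finiteness of dimension. *)
move=> v00; pose P n := iter n.+1 B v0 \in krylov B v0 n.+1.
have v0N : iter 0 B v0 \notin krylov B v0 0 by rewrite krylov0 memv0.
have minP n : (forall i, (i < n)%N -> ~~ P i) ->
    forall i, (i < n.+1)%N -> iter i B v0 \notin krylov B v0 i.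
  by move=> H [|i] //; apply: H.
have ex : exists n, P n.
  case: (boolP [exists n : 'I_(\dim {:V}), P n]) => [/existsP [n Pn]|/existsPn H].
    by exists n.
  have := dimvS (subvf (krylov B v0 (\dim {:V}).+1)).
  by rewrite dim_krylov ?ltnn //; apply: minP => i ltin; apply: (H (Ordinal ltin)).
case: (ex_minnP ex) => d Pd dmin; have H : forall i, (i < d)%N -> ~~ P i.
  by move=> i; rewrite ltnNge; apply: contra => /dmin.
by exists d; split; rewrite ?dim_krylov //; apply: (minP d).
Qed.
End KrylovDim.

(** * Parameters without integer exponents, and the central scalars *)

Section Params.
Variables (K : fieldType) (q a b c : K) (d : nat).
Hypothesis q0 : q != 0.
Let N := q ^+ d.

Lemma exprz_double n : q ^ (2 * n)%:Z = q ^+ n ^+ 2.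
Proof. by rewrite -exprnP mulnC exprM. Qed.

Lemma exprzN_double n : q ^ (- (2 * n)%:Z) = (q ^+ n ^+ 2)^-1.
Proof. by rewrite -invr_expz exprz_double. Qed.

Lemma thE n : th q a b c d n = a * N / q ^+ n ^+ 2.
Proof. by rewrite /th exprzN_double. Qed.

Lemma theE n : the q a b c d n = c / N * q ^+ n ^+ 2.
Proof. by rewrite /the exprz_double. Qed.

Lemma thsE n : ths q a b c d n = b * N / q ^+ n ^+ 2 + b^-1 / N * q ^+ n ^+ 2.
Proof. by rewrite /ths exprzN_double exprz_double. Qed.

Lemma phE n : ph q a b c d n =
  (q ^+ n - (q ^+ n)^-1) * (N * q / q ^+ n - (N * q)^-1 * q ^+ n)
    * (c - a * b * N * q / q ^+ n ^+ 2).
Proof.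
rewrite /ph !expfzDr // !expr1z exprzN_double -!invr_expz -!exprnP -/N ?expr1 ?exprN1 ?expr1z.
by field; rewrite ?expf_neq0 ?q0 //.
Qed.

Lemma pheE n : phe q a b c d n =
  (q ^+ n - (q ^+ n)^-1) * (N * q / q ^+ n - (N * q)^-1 * q ^+ n)
    * (a - b^-1 * c / (N * q) * q ^+ n ^+ 2).
Proof.
rewrite /phe !expfzDr // !expr1z exprz_double -!invr_expz -!exprnP -/N ?expr1 ?exprN1 ?expr1z.
(* Since [b] may be zero here, its inverse is treated as an independent variable. *)
by move: b^-1 => b'; field; rewrite ?expf_neq0 ?q0.
Qed.
End Params.

(* Solving the recursion writes [krylov_offdiag] as an affine function of [ga] whose
   slope does not vanish because [r] is not a root of unity. *)
Lemma offdiag_determines (K : fieldType) (r k ga x0 y0 t : K) n :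
  r != 0 -> k != 0 -> (forall i, (0 < i)%N -> r ^+ i != 1) ->
  krylov_offdiag r r^-1 k ga y0 n.+1 = (1 - r) * r ^+ n * x0 * t ->
  ga = y0 * (r ^+ n.+1 + 1) / (r ^+ n * (r + 1))
       + (1 - r) ^+ 2 * r ^+ n * x0 * t / (k * (1 - r ^+ n.+1)).
Proof.
move=> r0 k0 rN1.
have r1 : 1 - r != 0 by rewrite subr_eq0 eq_sym -[r]expr1 rN1.
have r2 : 1 + r != 0.
  have := rN1 2 isT; rewrite -subr_eq0 (_ : r ^+ 2 - 1 = - (1 - r) * (1 + r)); last by ring.
  by rewrite mulf_eq0 negb_or => /andP [].
have rn : 1 - r ^+ n.+1 != 0 by rewrite subr_eq0 eq_sym rN1.
(* Unrolled, the recursion is [k] times the sum over [i <= m] of [r^(m-i) (ga - r^(-i) y0)], a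
   difference of two geometric sums. *)
have E m : krylov_offdiag r r^-1 k ga y0 m.+1 =
    k * (ga * (1 - r ^+ m.+1) / (1 - r)
         - y0 * (1 - (r ^+ m.+1) ^+ 2) / ((1 - r) * (1 + r) * r ^+ m)).
  elim: m => [|m IH]; first by rewrite /= expr0 expr1; field; rewrite r1 r2.
  rewrite -[LHS]/(r * krylov_offdiag r r^-1 k ga y0 m.+1 + k * (ga - r^-1 ^+ m.+1 * y0)) IH.
  rewrite exprVn !exprS; have := expf_neq0 m r0; move: (r ^+ m) => R R0.
  by field; rewrite r0 r1 r2 R0.
rewrite E; move: rn; rewrite ![r ^+ n.+1]exprS; have := expf_neq0 n r0; move: (r ^+ n) => R R0 rn h.
have r2' : r + 1 != 0 by rewrite addrC.
apply: (mulfI (mulf_neq0 (mulf_neq0 k0 rn) (invr_neq0 r1))).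
have <- : k * (ga * (1 - r * R) / (1 - r) - y0 * (1 - (r * R) ^+ 2) / ((1 - r) * (1 + r) * R)) +
  k * (y0 * (1 - (r * R) ^+ 2) / ((1 - r) * (1 + r) * R)) = k * (1 - r * R) / (1 - r) * ga.
  by field; rewrite r1 r2 R0.
by rewrite h; field; rewrite rn k0 r2' R0 r1.
Qed.

(** * Coordinates in a basis and bidiagonal matrices *)

Section Coordinates.
Variables (K : fieldType) (V : vectType K) (n : nat) (M : n.-tuple V).

Definition coord_col v : 'cV[K]_n := \col_i coord M i v.

Lemma coord_col_linear : linear coord_col.
Proof. by move=> c v w; apply/colP => i; rewrite !mxE linearP. Qed.

HB.instance Definition _ := GRing.isLinear.Build K V 'cV[K]_n _ coord_col coord_col_linear.

Hypothesis basisM : basis_of {:V} M.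

Lemma lker_coord_col : lker (linfun coord_col) = 0%VS.
Proof.
apply/eqP; rewrite -subv0; apply/subvP => v; rewrite memv_ker lfunE memv0 => /eqP v0.
rewrite (coord_basis basisM (memvf v)) big1 // => i _.
by have /colP/(_ i) := v0; rewrite !mxE => ->; rewrite scale0r.
Qed.

Lemma limg_coord_col : limg (linfun coord_col) = fullv.
Proof.
apply/vspaceP => x; rewrite memvf; apply/memv_imgP.
exists (\sum_i x i 0 *: M`_i); rewrite ?memvf // lfunE; apply/colP => i.
by rewrite mxE coord_sum_free // (basis_free basisM).
Qed.

Lemma coord_col_intertwine (f : 'End(V)) (D : 'M[K]_n) :
  (forall j : 'I_n, f M`_j = \sum_i D i j *: M`_i) ->
  (linfun coord_col \o f = linfun (fun v : 'cV[K]_n => D *m v) \o linfun coord_col)%VF.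
Proof.
move=> fM; apply/lfunP => v; rewrite !comp_lfunE !lfunE; apply/colP => i.
have -> : f v = \sum_j coord M j v *: f M`_j.
  rewrite {1}(coord_basis basisM (memvf v)) linear_sum.
  by apply: eq_bigr => j _; exact: lfunZ.
rewrite !mxE; under eq_bigr => j _ do rewrite fM scaler_sumr.
rewrite exchange_big /=.
under eq_bigr => j _ do under eq_bigr => k _ do rewrite scalerA.
under eq_bigr => j _ do rewrite -scaler_suml.
rewrite coord_sum_free ?(basis_free basisM) //.
by apply: eq_bigr => j _; rewrite mxE mulrC.
Qed.
End Coordinates.

(** For the columns of [VdB]: in the last one the subdiagonal position falls outside the matrix,
    hence the test on [k]. *)
Lemma sum_diag_shift (K : fieldType) (V : vectType K) (m : nat -> V) n (s t : K) j k :
  (j < n)%N -> j != k ->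
  \sum_(i < n) (if i == j :> nat then s else if i == k :> nat then t else 0) *: m i =
  s *: m j + (if (k < n)%N then t *: m k else 0).
Proof.
move=> jn jk.
transitivity (\sum_(i < n | i == j :> nat) s *: m i + \sum_(i < n | i == k :> nat) t *: m i).
  rewrite [X in _ = X + _]big_mkcond [X in _ = _ + X]big_mkcond -big_split /=.
  apply: eq_bigr => i _; case: (eqVneq (i : nat) j) => [->|ij].
    by rewrite (negbTE jk) addr0.
  by case: eqVneq => _; rewrite ?scale0r add0r.
by rewrite (big_ord1_eq _ (fun i => s *: m i)) (big_ord1_eq _ (fun i => t *: m i)) jn.
Qed.

(** For the columns of [VdA] and [VdC]. In column 0 the truncated [j.-1] is again 0, so the
    coefficient [t] has to vanish there. *)
Lemma sum_upper_bidiag (K : fieldType) (V : vectType K) (m : nat -> V) n (s t : K) j :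
  (j < n)%N -> (j = 0%N -> t = 0) ->
  \sum_(i < n) (if i == j :> nat then s else if i.+1 == j :> nat then t else 0) *: m i =
  s *: m j + t *: m j.-1.
Proof.
case: j => [|j] jn t0.
  rewrite t0 // scale0r; have n0 : 0%N != n by rewrite neq_ltn jn.
  have := sum_diag_shift m s 0 jn n0; rewrite ltnn => <-.
  by apply: eq_bigr => i _ /=; rewrite if_same.
by rewrite sum_diag_shift ?neq_ltn ?ltnSn ?orbT // ltnW.
Qed.

(** * The vectors [m_i] and the action of [A] and [C] on them *)

Section StandardBasis.
Variables (K : fieldType) (V : vectType K) (A B C : 'End(V)) (v0 : V).
Variables (q a b c : K) (d : nat).
Hypotheses (q0 : q != 0) (b0 : b != 0) (q21 : q * q + 1 != 0).
Let N := q ^+ d.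
Let s := q ^+ 2 - q ^- 2.
Let al := (a * (q * N + (q * N)^-1) + c * (b + b^-1)) / (q + q^-1).
Let ga := (c * (q * N + (q * N)^-1) + a * (b + b^-1)) / (q + q^-1).
Hypothesis AB : forall x, A (B x) = q ^- 2 *: B (A x) + (q^-1 * s) *: (ga *: x - C x).
Hypothesis CB : forall x, C (B x) = q ^+ 2 *: B (C x) + (- (q * s)) *: (al *: x - A x).
Hypothesis Av0 : A v0 = (a * N) *: v0.
Hypothesis Cv0 : C v0 = (c / N) *: v0.

Fixpoint std_vec n := if n is n'.+1 then B (std_vec n') - ths q a b c d n' *: std_vec n' else v0.

Lemma B_std_vec n : B (std_vec n) = ths q a b c d n *: std_vec n + std_vec n.+1.
Proof. by rewrite addrC subrK. Qed.

(** Induction moving [A] and [C] past [B - theta*_n]. The scalars [al] and [ga] enter through the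
    coefficient of [std_vec n]. The index is not bounded by [d], so that [d.+1] can be examined as
    well. *)
Lemma std_vec_action n :
  A (std_vec n) = th q a b c d n *: std_vec n + ph q a b c d n *: std_vec n.-1 /\
  C (std_vec n) = the q a b c d n *: std_vec n + phe q a b c d n *: std_vec n.-1.
Proof.
have N0 : N != 0 by apply: expf_neq0.
elim: n => [|n [IA IC]].
  rewrite thE phE // theE pheE // !expr0 /= Av0 Cv0.
  by split; rewrite -/N; to_scalars; field; rewrite ?N0 ?q0 ?b0 ?oner_neq0.
have mS : std_vec n.+1 = B (std_vec n) - ths q a b c d n *: std_vec n by [].
have Bw : B (std_vec n) = std_vec n.+1 + ths q a b c d n *: std_vec n by rewrite mS subrK.
(* For [n = 0] the vector [std_vec n.-1] is [v0] again, but its coefficients [ph] and [phe] vanish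
   at index 0. *)
have Bu : n = 0%N \/ exists2 n', n = n'.+1 &
    B (std_vec n.-1) = std_vec n + ths q a b c d n' *: std_vec n.-1.
  by case: (n) => [|n']; [left|right; exists n' => //=; rewrite subrK].
have Q0 := expf_neq0 n q0.
rewrite [n.+1.-1]/=; split.
- rewrite {1}mS lfunD lfunN lfunZ AB IA IC lfunD !lfunZ Bw.
  move: (std_vec n) (std_vec n.-1) (std_vec n.+1) Bu => w u m1.
  case=> [n0|[n' nS ->]].
    rewrite !n0 /= !(thE, thsE, theE, phE, pheE) // -/N !expr1 !expr0; to_scalars.
    by rewrite /s /ga; field; rewrite ?expf_neq0 ?q0 ?N0 ?b0 ?oner_neq0 ?q21.
  rewrite !nS /= !(thE, thsE, theE, phE, pheE) // -/N !(exprS q n'.+1) !(exprS q n'); to_scalars.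
    by rewrite /s /ga; field; rewrite ?expf_neq0 ?q0 ?N0 ?b0 ?oner_neq0 ?q21.
- rewrite {1}mS lfunD lfunN lfunZ CB IC IA lfunD !lfunZ Bw.
  move: (std_vec n) (std_vec n.-1) (std_vec n.+1) Bu => w u m1.
  case=> [n0|[n' nS ->]].
    rewrite !n0 /= !(thE, thsE, theE, phE, pheE) // -/N !expr1 !expr0; to_scalars.
    by rewrite /s /al; field; rewrite ?expf_neq0 ?q0 ?N0 ?b0 ?oner_neq0 ?q21.
  rewrite !nS /= !(thE, thsE, theE, phE, pheE) // -/N !(exprS q n'.+1) !(exprS q n'); to_scalars.
    by rewrite /s /al; field; rewrite ?expf_neq0 ?q0 ?N0 ?b0 ?oner_neq0 ?q21.
Qed.
End StandardBasis.

(** Take a root of [X^2 - t X + 1]; its constant term keeps the root away from 0. *)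
Lemma exists_add_inv (K : fieldType) (t : K) :
  (forall p : {poly K}, size p != 1%N -> exists x, root p x) ->
  exists2 b, b != 0 & b + b^-1 = t.
Proof.
move=> Kclosed; have pE : Poly [:: 1; - t; 1] = [:: 1; - t; 1] :> seq K.
  by rewrite (@PolyK _ 0) //= oner_neq0.
have [|b] := @Kclosed (Poly [:: 1; - t; 1]); first by rewrite pE.
rewrite /root horner_Poly /= mul0r add0r mul1r => /eqP e.
have b0 : b != 0 by apply: contra_eq_neq e => ->; rewrite mulr0 add0r oner_neq0.
exists b => //; apply: (mulIf b0); rewrite mulrDl mulVf //.
by apply/eqP; rewrite -subr_eq0 -e; apply/eqP; ring.
Qed.

Lemma memv_span_stable (K : fieldType) (V : vectType K) (m : nat -> V) n (f : 'End(V)) :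
  (forall i, (i < n)%N -> f (m i) \in <<mkseq m n>>%VS) ->
  forall v, v \in <<mkseq m n>>%VS -> f v \in <<mkseq m n>>%VS.
Proof.
move=> H v vM; have: (f @: <<mkseq m n>> <= <<mkseq m n>>)%VS.
  rewrite limg_span; apply/span_subvP => _ /mapP [_ /mapP [i + ->] ->].
  by rewrite mem_iota add0n; apply: H.
by move/subvP; apply; apply: memv_img.
Qed.

(** * Classification of the irreducible modules *)

Section Classification.
Variables (K : fieldType) (q : K).
Hypothesis Kclosed : forall p : {poly K}, size p != 1%N -> exists x, root p x.
Hypothesis hq : not_root_of_unity q.
Variables (V : vectType K) (A B C : 'End(V)).
Hypothesis irr : Hq_irreducible A B C.
Let s := q ^+ 2 - q ^- 2.

Let q0 : q != 0. Proof. by case: hq. Qed.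
Let qN1 n : (0 < n)%N -> q ^+ n != 1. Proof. by case: hq => _; apply. Qed.
Let q2N1 n : (0 < n)%N -> (q ^+ 2) ^+ n != 1.
Proof. by move=> n0; rewrite -exprM qN1 // muln_gt0. Qed.
Let q20 : q ^+ 2 != 0. Proof. exact: expf_neq0. Qed.
Let qm1 : q * q - 1 != 0. Proof. by rewrite subr_eq0; apply: (@qN1 2). Qed.
Let qp1 : q * q + 1 != 0.
Proof.
have : (q * q - 1) * (q * q + 1) != 0.
  by rewrite (_ : _ * _ = q ^+ 4 - 1); [rewrite subr_eq0 qN1|ring].
by rewrite mulf_eq0 negb_or => /andP [].
Qed.
Let s0 : s != 0.
Proof.
rewrite (_ : s = (q * q - 1) * (q * q + 1) / q ^+ 2); last by rewrite /s; field.
by rewrite !mulf_neq0 ?invr_neq0.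
Qed.

Lemma Hq_module_scalars : is_Hq_module q A B C -> exists al be ga,
  [/\ forall x, A (B x) = q ^- 2 *: B (A x) + (q^-1 * s) *: (ga *: x - C x),
      forall x, C (B x) = q ^+ 2 *: B (C x) + (- (q * s)) *: (al *: x - A x)
    & forall x, A (C x) - be *: x = q ^+ 2 *: (C (A x) - be *: x)].
Proof.
case=> cA cB cC.
have [al hal] := central_scalar Kclosed irr cA.
have [be hbe] := central_scalar Kclosed irr cB.
have [ga hga] := central_scalar Kclosed irr cC.
(* With [b' = be q / (q^2 - 1)], the relation [q C A - q^-1 A C = be] reads
   [A C - b' = q^2 (C A - b')]. *)
exists al, (be * q / (q * q - 1)), ga; split=> x.
- rewrite -hga /qbracket !lfun_simp -/s.
  by to_scalars; field; rewrite ?q0 ?s0 ?oner_neq0.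
- rewrite -hal /qbracket !lfun_simp -/s.
  by to_scalars; field; rewrite ?q0 ?s0 ?oner_neq0.
have -> : be * q / (q * q - 1) *: x = (q / (q * q - 1)) *: (be *: x).
  by to_scalars; field; rewrite ?qm1.
rewrite -hbe /qbracket !lfun_simp.
by to_scalars; field; rewrite ?q0 ?qm1 ?oner_neq0.
Qed.

Theorem Hq_irreducible_classification : is_Hq_module q A B C ->
  exists (a b c : K) (d : nat), b != 0 /\
    Hq_isomorphic A B C (Vd_A q a b c d) (Vd_B q a b c d) (Vd_C q a b c d).
Proof.
move=> /Hq_module_scalars [al [be [ga [AB CB AC]]]].
have [la [mu [v0 [v00 Av0 Cv0]]]] :=
  common_eigenvector_of_qcommuting Kclosed (proj1 irr) q20 q2N1 AC.
have [d [vd vS dimW]] := krylov_stops B v00.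
have Wfull : krylov B v0 d.+1 = fullv.
  apply: (Hq_irreducible_submodule irr v00).
  - have := iter_krylov B v0 0; apply: subvP.
    by elim: (d) => // n; move/subv_trans; apply; apply: krylov_subS.
  - exact: (krylov_f_stable AB CB Av0 Cv0).
  - by move=> v; apply: krylov_stable.
  - exact: (krylov_f_stable CB AB Cv0 Av0).
have dimV : \dim {:V} = d.+1 by rewrite -Wfull.
have [t vt] := krylovSP _ _ _ _ vS.
pose N := q ^+ d.
have N0 : N != 0 by apply: expf_neq0.
have NN1 : (q * N) ^+ 2 - 1 != 0 by rewrite subr_eq0 /N -exprS exprAC q2N1.
have NN1' : 1 - (q * N) ^+ 2 != 0 by rewrite -opprB oppr_eq0.
have q41 : (q * q) ^+ 2 - 1 != 0 by rewrite subr_eq0 -expr2 q2N1.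
have q41' : - ((q * q) ^+ 2 - 1) != 0 by rewrite oppr_eq0.
(* The right-hand side is [t / [d+1]_q], as [[d+1]_q = ((q N)^2 - 1) / (N (q^2 - 1))]. *)
have [b b0 bE] := exists_add_inv (t * N * (q * q - 1) / ((q * N) ^+ 2 - 1)) Kclosed.
pose a := la / N; pose c := mu * N.
have tE : t = (b + b^-1) * ((q * N) ^+ 2 - 1) / (N * (q * q - 1)).
  by rewrite bE; field; rewrite ?N0 ?qm1 ?NN1.
have qV0 : q ^- 2 != 0 by rewrite invr_eq0.
have qVN1 n : (0 < n)%N -> (q ^- 2) ^+ n != 1 by move=> n0; rewrite exprVn invr_eq1 q2N1.
have k10 : q^-1 * s != 0 by rewrite mulf_neq0 ?invr_neq0.
have k20 : - (q * s) != 0 by rewrite oppr_eq0 mulf_neq0.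
have gaE : ga = (c * (q * N + (q * N)^-1) + a * (b + b^-1)) / (q + q^-1).
  (* The two ratios must be visibly inverse to each other for [offdiag_determines]. *)
  have CB' : forall x, C (B x) = (q ^- 2)^-1 *: B (C x) + (- (q * s)) *: (al *: x - A x).
    by move=> x; rewrite invrK CB.
  rewrite (offdiag_determines qV0 k10 qVN1 (krylov_offdiag_closed AB CB' Av0 Cv0 vd vt)).
  by rewrite tE exprS !exprVn exprAC -/N /a /c /s; field; rewrite ?q0 ?qp1 ?b0 ?N0 ?NN1 ?NN1' ?q41 ?q41' ?qm1.
have alE : al = (a * (q * N + (q * N)^-1) + c * (b + b^-1)) / (q + q^-1).
  rewrite (offdiag_determines q20 k20 q2N1 (krylov_offdiag_closed CB AB Cv0 Av0 vd vt)).
  by rewrite tE exprS exprAC -/N /a /c /s; field; rewrite ?q0 ?qp1 ?b0 ?N0 ?NN1 ?NN1' ?q41 ?q41' ?qm1.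
subst ga al; have laE : la = a * N by rewrite /a divfK.
have muE : mu = c / N by rewrite /c mulfK.
have Av0' : A v0 = (a * q ^+ d) *: v0 by rewrite Av0 {1}laE.
have Cv0' : C v0 = (c / q ^+ d) *: v0 by rewrite Cv0 {1}muE.
have act := std_vec_action q0 b0 qp1 AB CB Av0' Cv0'.
set m := std_vec B v0 q a b c d in act.
have Bm n : B (m n) = ths q a b c d n *: m n + m n.+1 by apply: B_std_vec.
(* At index [d.+1] the factor [N q / q^(d+1) - q^(d+1) / (N q)] is [1 - 1]. *)
have phd : ph q a b c d d.+1 = 0.
  by rewrite phE // exprS -/N; field; rewrite ?q0 ?N0.
have phed : phe q a b c d d.+1 = 0.
  by rewrite pheE // exprS -/N; field; rewrite ?q0 ?N0 ?b0.
have md : m d.+1 = 0.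
  have [Am Cm] := act d.+1.
  rewrite phd phed !scale0r !addr0 in Am Cm.
  have mW : m d.+1 \in krylov B v0 d.+1 by rewrite Wfull memvf.
  case: (eqVneq la 0) => [la0|la0]; last first.
    apply: (krylov_eigenvector_eq0 AB CB Av0 Cv0 mW Am) => i id.
    have -> : th q a b c d d.+1 = (q ^- 2) ^+ d.+1 * la.
      by rewrite thE exprVn -exprM mulnC exprM laE mulrC.
    rewrite (inj_eq (mulIf la0)) (inj_eq (expf_inj_not_root qV0 qVN1)).
    by rewrite neq_ltn id orbT.
  case: (eqVneq mu 0) => [mu0|mu0]; last first.
    apply: (krylov_eigenvector_eq0 CB AB Cv0 Av0 mW Cm) => i id.
    have -> : the q a b c d d.+1 = (q ^+ 2) ^+ d.+1 * mu.
      by rewrite theE exprAC muE mulrC.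
    rewrite (inj_eq (mulIf mu0)) (inj_eq (expf_inj_not_root q20 q2N1)).
    by rewrite neq_ltn id orbT.
  have a0 : a = 0 by rewrite /a la0 mul0r.
  have c0 : c = 0 by rewrite /c mu0 mul0r.
  (* Now both central scalars vanish, so [B] preserves the common kernel of [A] and [C]. *)
  have ker_full : (lker A :&: lker C)%VS = fullv.
    have kP v : reflect (A v = 0 /\ C v = 0) (v \in lker A :&: lker C)%VS.
      by rewrite memv_cap !memv_ker; apply: (iffP andP) => -[/eqP ? /eqP ?].
    apply: (Hq_irreducible_submodule irr v00).
    - by apply/kP; rewrite Av0 Cv0 la0 mu0 !scale0r.
    - by move=> v /kP [-> _]; rewrite mem0v.
    - move=> v /kP [Av Cv]; apply/kP; rewrite AB CB Av Cv a0 c0.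
      by rewrite !(mul0r, addr0, linear0, scale0r, scaler0, subr0).
    - by move=> v /kP [_ ->]; rewrite mem0v.
  have AC0 v : A v = 0 /\ C v = 0.
    have := memvf v; rewrite -ker_full memv_cap !memv_ker.
    by case/andP => /eqP ? /eqP ?.
  have [x [w w0 Bw]] := exists_eigenvector Kclosed B (proj1 irr).
  (* As [A] and [C] are zero, an eigenline of [B] is a submodule. *)
  have line_full : <[w]>%VS = fullv.
    apply: (Hq_irreducible_submodule irr w0); first exact: memv_line.
    - by move=> v _; rewrite (proj1 (AC0 v)) mem0v.
    - by move=> _ /vlineP [e ->]; rewrite lfunZ Bw !memvZ // memv_line.
    - by move=> v _; rewrite (proj2 (AC0 v)) mem0v.
  have d0 : d = 0%N by move: dimV; rewrite -line_full dim_vline w0 => -[].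
  move: vt; rewrite {1 2 3}d0 krylov0 memv0 subr_eq0 /= => /eqP Bv0.
  (* For [d = 0] one has [theta*_0 = b + b^-1 = t], so [m 1 = B v0 - t *: v0 = 0]. *)
  rewrite d0 /m /= Bv0 thsE tE -/N (_ : N = 1) ?/N ?d0 //.
  by to_scalars; field; rewrite ?b0 ?qm1 ?oner_neq0.
pose M : d.+1.-tuple V := Tuple (introT eqP (size_mkseq m d.+1)).
have mM i : (i < d.+1)%N -> m i \in <<mkseq m d.+1>>%VS.
  by move=> id; apply/memv_span/map_f; rewrite mem_iota.
(* The span is a submodule containing [v0]; [d.+1] vectors spanning a space of dimension [d.+1] form
   a basis. *)
have Mfull : <<mkseq m d.+1>>%VS = fullv.
  apply: (Hq_irreducible_submodule irr v00); first exact: (mM 0).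
  - apply: memv_span_stable => i id; have [-> _] := act i.
    by rewrite memvD // memvZ ?mM // (leq_ltn_trans (leq_pred i)).
  - apply: memv_span_stable => i id; rewrite Bm; apply: memvD; first by rewrite memvZ ?mM.
    move: id; rewrite ltnS leq_eqVlt => /orP [/eqP ->|id]; last exact: mM.
    by rewrite md mem0v.
  - apply: memv_span_stable => i id; have [_ ->] := act i.
    by rewrite memvD // memvZ ?mM // (leq_ltn_trans (leq_pred i)).
have basisM : basis_of {:V} M by rewrite basisEdim Mfull dimV size_mkseq subvv leqnn.
have Mi (i : 'I_d.+1) : M`_i = m i by rewrite nth_mkseq.
have sumM (D : 'M[K]_d.+1) j : \sum_i D i j *: M`_i = \sum_i D i j *: m i.
  by apply: eq_bigr => i _; rewrite Mi.
exists a, b, c, d; split=> //; exists (linfun (coord_col M)); split.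
- exact: lker_coord_col.
- exact: limg_coord_col.
- apply: (coord_col_intertwine basisM) => j; rewrite sumM Mi; have [-> _] := act j.
  under eq_bigr do rewrite mxE.
  by rewrite sum_upper_bidiag ?ltn_ord // => ->; rewrite phE // expr0 invr1 subrr !mul0r.
- apply: (coord_col_intertwine basisM) => j; rewrite sumM Mi Bm.
  under eq_bigr do rewrite mxE.
  rewrite sum_diag_shift ?ltn_ord ?neq_ltn ?ltnSn // scale1r.
  (* In the last column [j = d], and the missing term is [m d.+1 = 0]. *)
  case: ifP => // jd; congr (_ + _); rewrite -md; congr m.
  by apply/eqP; rewrite eqn_leq ltn_ord leqNgt jd.
- apply: (coord_col_intertwine basisM) => j; rewrite sumM Mi; have [_ ->] := act j.
  under eq_bigr do rewrite mxE.
  by rewrite sum_upper_bidiag ?ltn_ord // => ->; rewrite pheE // expr0 invr1 subrr !mul0r.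
Qed.
End Classification.

Theorem mainTheorem10 (q : Cplx) (hq : not_root_of_unity q)
  (V : vectType Cplx) (A B C : 'End(V)) :
  is_Hq_module q A B C -> Hq_irreducible A B C ->
  exists (a b c : Cplx) (d : nat),
    b != 0 /\
    Hq_isomorphic A B C (Vd_A q a b c d) (Vd_B q a b c d) (Vd_C q a b c d).
Proof.
move=> hM irr; apply: Hq_irreducible_classification => // p.
exact: (elimT (@closed_rootP (Rdefinitions.R)[i] p)).
Qed.
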